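(* Let $G$ be a countably infinite discrete FC group (every conjugacy class of $G$ is finite) and let $G\curvearrowright X$ be a free action by homeomorphisms on a compact metrizable space. If the action has the marker property, then it has property FCSB.
   Context: A set $U\subset X$ is $L$-free (for finite $L\subset G$) if the translates $gU$, $g\in L$, are pairwise disjoint. A marker set is an open set $U\subset X$ with $\bigcup_{g\in G}gU=X$. The marker property: for every finite $L\subset G$ there is an $L$-free marker set. Subequivalence: for closed sets $A_1,\dots,A_p\subset X$ and an open set $B\subset X$, $\sum_i[A_i]\prec B$ means that for each $i$ there is a finite open cover $\{U_{i,k}\}_k$ of $A_i$ and elements $g_{i,k}\in G$ such that all the sets $g_{i,k}U_{i,k}$ (over all pairs $(i,k)$) are pairwise disjoint subsets of $B$. Property FCSB (free covers with staggered boundaries): the action has the marker property, and for every finite $F\subset G$ and every marker set $V$ there is a finite collection $\{U_i\}_{i=1}^n$ of $F$-free open sets with $\sum_{i=1}^n[\partial U_i]+\left[X\setminus\bigcup_{i=1}^nU_i\right]\prec V$. *)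

(* Defs.v *)
From mathcomp Require Import all_boot.
From mathcomp Require Import all_classical reals topology.

Set Implicit Arguments.
Unset Strict Implicit.
Unset Printing Implicit Defensive.

Local Open Scope group_scope.
Local Open Scope classical_set_scope.

Definition FC_group (G : groupType) : Prop :=
  forall g : G, finite_set [set g ^ h | h in [set: G]].

Definition boundary (X : topologicalType) (U : set X) : set X :=
  closure U `\` U°.

Section Actions.
Context {G : groupType} {X : topologicalType}.
Implicit Types (act : G -> X -> X) (L F : set G) (U V B : set X).

(* Each [act g] is a homeomorphism, its inverse being [act g^-1]. *)
Definition continuous_action act : Prop :=
  [/\ forall x, act 1 x = x,
      forall g h x, act (g * h) x = act g (act h x)
    & forall g, continuous (act g)].

Definition free_action act : Prop := forall g x, act g x = x -> g = 1.

(* [trivIset] is disjointness of an indexed family: for distinct [g] and [h]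
   in [L], the translates [gU] and [hU] are disjoint, so they cannot coincide
   unless [U] is empty. *)
Definition free_set act L U : Prop :=
  trivIset L (fun g => act g @` U).

Definition marker_set act U : Prop :=
  open U /\ \bigcup_g (act g @` U) = [set: X].

Definition marker_property act : Prop :=
  forall L, finite_set L ->
    exists2 U, marker_set act U & free_set act L U.

(* [\sum_i [A i] \prec B]. The cover of [A i] consists of the open subsets
   [U i k] of [X] with [k < m i]. The relation is meant for closed [A i] and
   open [B]. *)
Definition subequivalent act (I : finType) (A : I -> set X) B : Prop :=
  exists (m : I -> nat) (U : I -> nat -> set X) (g : I -> nat -> G),
    [/\ forall i k, (k < m i)%N -> open (U i k),
        forall i, A i `<=` \bigcup_(k in `I_(m i)) U i k,
        forall i k, (k < m i)%N -> act (g i k) @` U i k `<=` B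
      & trivIset [set ik : I * nat | (ik.2 < m ik.1)%N]
                 (fun ik => act (g ik.1 ik.2) @` U ik.1 ik.2)].

(* The left-hand side of the subequivalence has [n + 1] terms: [Some i] indexes
   the boundary of [U i], and [None] the complement of the union. *)
Definition FCSB act : Prop :=
  marker_property act /\
  forall F V, finite_set F -> marker_set act V ->
    exists (n : nat) (U : 'I_n -> set X),
      (forall i, open (U i) /\ free_set act F (U i)) /\
      subequivalent act
        (fun o : option 'I_n =>
           if o is Some i then boundary (U i) else ~` \bigcup_i U i) V.

End Actions.

(* Main.v *)
(* Let K be finite such that every x is moved into V by some k in K, and let W be
   an L-free marker set, where L contains K and all conjugates of elements of F
   (finite because G is FC). Conjugation invariance makes every translate of W
   F-free. Choose psi continuous, positive only on W and so large that finitely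
   many translates g_i^-1 {psi > N}, i < N, cover X. Lowering the thresholds to the
   distinct values 1, ..., N keeps a cover by F-free sets
   U_i = {x | psi (g_i x) > i + 1}, and now the boundaries, pushed by g_i, lie in
   disjoint level sets of psi inside W. As W is K-free, these fit disjointly into
   V after being moved by elements of K. *)
Require Import Defs.
From mathcomp Require Import all_boot all_order all_algebra finmap.
From mathcomp Require Import all_classical reals ereal topology normedtype.
From mathcomp Require Import lra.

Import Order.TTheory GRing.Theory Num.Theory.
Import numFieldNormedType.Exports.

Local Open Scope ring_scope.
Local Open Scope classical_set_scope.

Lemma compact_nondecreasing_cover {X : topologicalType} {P : nat -> set X} :
  compact [set: X] -> (forall n, open (P n)) ->
  {homo P : m n / (m <= n)%N >-> m `<=` n} ->
  (forall x, exists n, P n x) -> exists n, forall x, P n x.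
Proof.
move=> /compact_near_coveringP cX oP homoP coverP.
have [x _|N _ PN] := cX nat \oo P _; last first.
  by exists N => x; exact: (PN N (leqnn N) x).
have [n Pnx] := coverP x.
exists (P n, [set m | (n <= m)%N]) => /=.
  by split; [exact: open_nbhs_nbhs | exists n].
by move=> [y m] /= [Pny nm]; exact: homoP nm y Pny.
Qed.

(** The distance to the complement of [W] works: it vanishes exactly on that closed set. *)
Lemma open_cozero {R : realType} {X : metricType R} {W : set X} : open W ->
  exists f : X -> R, continuous f /\ forall x, W x <-> 0 < f x.
Proof.
(* The distance to the empty set is infinite, so a constant replaces it when [W] is the whole
   space. *)
move=> oW; have [W0|/set0P[a Wa]] := eqVneq (~` W) set0.
  exists (fun=> 1); split=> [x|x]; first exact: cvg_cst.
  by split=> // _; apply: contrapT => Wx; have : (~` W) x by []; rewrite W0.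
have dfin x : edist_inf (~` W) x \is a fin_num.
  rewrite ge0_fin_numE ?edist_inf_ge0//.
  apply: (@le_lt_trans _ _ (edist (x, a))).
    by apply: ereal_inf_lbound; exists a.
  rewrite -ge0_fin_numE ?edist_ge0//; apply/edist_finP.
  exists (mdist x a + 1); first by rewrite ltr_wpDl ?mdist_ge0.
  by rewrite ballEmdist/= ltrDl.
exists (fine \o edist_inf (~` W)); split=> [x|x].
  by apply: fine_cvg; rewrite fineK//; exact: edist_inf_continuous.
split=> [Wx|].
  have /nbhs_ballP[e/= e0 xeW] : nbhs x W by exact: open_nbhs_nbhs.
  rewrite -lte_fin fineK//; apply: (@lt_le_trans _ _ e%:E) => //.
  apply: le_ereal_inf_tmp => _ [b Wb <-]; rewrite leNgt; apply/negP.
  by move=> /edist_lt_ball/xeW.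
by move=> fx0; apply: contrapT => Wx; move: fx0; rewrite /= edist_inf0//= ltxx.
Qed.

(** Finite subsets of the group become a chain indexed by [nat], the form in which compactness is
    applied below. *)
Lemma countable_exhaustion {G : choiceType} : countable [set: G] ->
  exists s : nat -> seq G, [/\ forall n, uniq (s n),
    forall m n, (m <= n)%N -> {subset s m <= s n} &
    forall g, exists n, g \in s n].
Proof.
move=> /countable_injP[e einj].
have fin n : finite_set [set g | (e g <= n)%N].
  rewrite [X in finite_set X](_ : _ = e @^-1` `I_n.+1) //.
  by apply: finite_preimage => // x y _ _; apply: einj; exact: in_setT.
exists (fun n => enum_fset (fset_set [set g | (e g <= n)%N])); split=> [n|m n mn g|g].
- exact: fset_uniq.
- by rewrite !in_fset_set// !inE/= => /leq_trans; exact.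
- by exists (e g); rewrite in_fset_set// inE/=.
Qed.

(** The closure stays in the closed set [t <= f], while points with [t < f] are interior. *)
Lemma boundary_superlevel {R : realType} {X : topologicalType} {f : X -> R}
    {t : R} {x} : continuous f -> boundary [set y | t < f y] x -> f x = t.
Proof.
move=> cf [clx nix]; apply/eqP; rewrite eq_le; apply/andP; split.
  rewrite leNgt; apply/negP => tfx; apply: nix.
  apply: open_nbhs_nbhs; split=> //.
  by have /continuousP/(_ _ (@open_gt R t)) := cf.
suff : closed [set y | t <= f y].
  by apply; apply: closureS clx => y /=; exact: ltW.
by apply: (@preimage_closed _ _ f [set y | t <= y]) => [y _|]; [exact: cf|exact: closed_ge].
Qed.

Lemma bigcup_actP {G : groupType} {X : topologicalType} {act : G -> X -> X}
    {U : set X} : continuous_action act ->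
  \bigcup_g (act g @` U) = [set: X] -> forall x, exists g, U (act g x).
Proof.
move=> [act1 actM _] UT x.
have [g _ [y Uy <-]] : (\bigcup_g (act g @` U)) x by rewrite UT.
by exists g^-1%g; rewrite -actM mulVg act1.
Qed.

Lemma free_setP {G : groupType} {X : topologicalType} {act : G -> X -> X}
    {L : set G} {U : set X} {g h : G} {x y : X} :
  free_set act L U -> L g -> L h -> U x -> U y -> act g x = act h y -> g = h.
Proof.
move=> freeU Lg Lh Ux Uy gxhy; apply: (freeU g h) => //.
by exists (act g x); split; [exists x | exists y].
Qed.

Lemma sub_free_set {G : groupType} {X : topologicalType}
    {act : G -> X -> X} {L : set G} {U V : set X} :
  U `<=` V -> free_set act L V -> free_set act L U.
Proof.
move=> UV freeV g h Lg Lh [_ [[x Ux <-] [y Uy yx]]].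
exact: free_setP freeV Lg Lh (UV _ Ux) (UV _ Uy) (esym yx).
Qed.

(** The set is $g^{-1}W$, and $h g^{-1}W = g^{-1}(ghg^{-1})W$. Disjointness over [F] thus reduces to
    disjointness over conjugates, and conjugation is injective. *)
Lemma free_set_translate {G : groupType} {X : topologicalType}
    {act : G -> X -> X} {F : set G} {W : set X} (g : G) :
  continuous_action act ->
  free_set act (\bigcup_(h in F) [set (h ^ k)%g | k in [set: G]]) W ->
  free_set act F [set x | W (act g x)].
Proof.
move=> [_ actM _] freeW h h' Fh Fh' [_ [[x Wx <-] [x' Wx' hx]]].
have conj_act k y : act (k ^ g^-1)%g (act g y) = act g (act k y).
  by rewrite -!actM conjgE invgK -!mulgA mulVg mulg1.
apply: (@conjg_inj _ g^-1%g).
apply: (free_setP freeW _ _ Wx Wx'); rewrite ?conj_act ?hx//.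
- by exists h => //; exists g^-1%g.
- by exists h' => //; exists g^-1%g.
Qed.

(** Points sent into [Q n] by an element of [s n] form an increasing sequence of open sets, so a
    single [n] bounds both the group elements and the index of [Q]. *)
Lemma compact_translate_cover {G : groupType} {X : topologicalType}
    {act : G -> X -> X} {s : nat -> seq G} {Q : nat -> set X} :
  compact [set: X] -> continuous_action act ->
  (forall m n, (m <= n)%N -> {subset s m <= s n}) ->
  (forall g, exists n, g \in s n) ->
  (forall n, open (Q n)) -> {homo Q : m n / (m <= n)%N >-> m `<=` n} ->
  (forall x, exists n g, Q n (act g x)) ->
  exists n, forall x, exists2 g, g \in s n & Q n (act g x).
Proof.
move=> cX [_ _ cact] homos covers oQ homoQ coverQ.
apply: (@compact_nondecreasing_cover _
  (fun n => [set x | exists2 g, g \in s n & Q n (act g x)])) => //.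
- move=> n; rewrite [X in open X](_ : _ =
    \bigcup_(g in [set` s n]) (act g @^-1` Q n)); last first.
    by apply/seteqP; split => x [g]; exists g.
  apply: bigcup_open => g _.
  by have /continuousP := cact g; apply.
- by move=> m n mn x [g /(homos _ _ mn) gn /(homoQ _ _ mn)]; exists g.
- move=> x; have [m [g Qmx]] := coverQ x; have [n gn] := covers g.
  exists (maxn m n), g; first exact: homos (leq_maxr m n) _ gn.
  exact: homoQ (leq_maxl m n) _ Qmx.
Qed.

(** Radius 1/2 is small enough to keep thickened integer levels disjoint. *)
Lemma nat_near_inj {R : realFieldType} {r : R} {i j : nat} :
  `|r - i.+1%:R| < 2^-1 -> `|r - j.+1%:R| < 2^-1 -> i = j.
Proof.
rewrite !ltr_distl => /andP[i1 i2] /andP[j1 j2].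
have ij : (i.+1 < j.+1.+1)%N.
  by rewrite -(ltr_nat R) -[j.+2%:R]natr1; lra.
have ji : (j.+1 < i.+1.+1)%N.
  by rewrite -(ltr_nat R) -[i.+2%:R]natr1; lra.
by apply/eqP; rewrite -eqSS eqn_leq -ltnS ij -ltnS ji.
Qed.

Theorem proposition4p3 (R : realType) (G : groupType) (X : metricType R)
    (act : G -> X -> X) :
  countable [set: G] ->
  infinite_set [set: G] ->
  FC_group G ->
  compact [set: X] ->
  continuous_action act ->
  free_action act ->
  marker_property act ->
  FCSB act.
Proof.
move=> cG _ fcG cX actX _ mpG; split=> // F V finF [oV VT].
have [act1 actM cact] := actX.
have [s [us ss es]] := countable_exhaustion cG.
have [a Va] : exists a, forall x, exists2 k, k \in s a & V (act k x).
  apply: (compact_translate_cover (Q := fun=> V) cX actX ss es) => [//|m n _ //|x].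
  by exists 0%N; exact: bigcup_actP actX VT x.
pose L := [set` s a] `|` \bigcup_(h in F) [set (h ^ k)%g | k in [set: G]].
have [|W [oW WT] freeW] := mpG L.
  by rewrite finite_setU; split; [exact: finite_seq|exact: bigcup_finite].
have freeWF : free_set act
    (\bigcup_(h in F) [set (h ^ k)%g | k in [set: G]]) W.
  by apply: sub_trivIset freeW; exact: subsetUr.
have [f [cf fW]] := open_cozero oW.
have cMf c : continuous (fun x => c * f x).
  by move=> x; apply: cvgM; [exact: cvg_cst|exact: cf].
have o_superlevel (h : X -> R) t : continuous h -> open [set x | t < h x].
  by move=> /continuousP/(_ _ (@open_gt R t)).
have [b fb] : exists b : nat, forall x,
    exists2 g, g \in s b & 1 < b%:R * f (act g x).
  apply: (compact_translate_cover
    (Q := fun n => [set x | 1 < n%:R * f x]) cX actX ss es).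
  - by move=> n; exact: o_superlevel.
  - move=> m n mn x /= fx; apply: lt_le_trans (fx) _; rewrite ler_wpM2r ?ler_nat//.
    (* The sign of [f] off [W] is unknown, but a negative value would contradict [1 < m * f x]. *)
    rewrite leNgt; apply/negP => /ltW f0; move: fx; apply/negP.
    by rewrite -leNgt (le_trans (mulr_ge0_le0 _ f0)).
  - move=> x; have [g /fW fx] := bigcup_actP actX WT x.
    exists (Num.bound (f (act g x))^-1), g => /=.
    by rewrite -ltr_pdivrMr// mul1r archi_boundP// invr_ge0 ltW.
(* The factor [N] turns [1 < b * f] into [N < psi], so the translates by the [N] elements of [s b]
   still cover at height [N]. *)
pose N := size (s b); pose psi x := N%:R * b%:R * f x.
have cpsi : continuous psi by exact: cMf.
have psiW x : 0 < psi x -> W x.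
  apply: contraPP => /fW/negP; rewrite -leNgt => fx; apply/negP.
  by rewrite -leNgt mulr_ge0_le0// mulr_ge0.
pose g_ i := nth 1%g (s b) i.
have c_act g : continuous (psi \o act g).
  by move=> x; apply: continuous_comp; [exact: cact|exact: cpsi].
(* Indices start at 0, so the thresholds run from 1 to [N]: positive, hence inside [W], and low
   enough to keep the cover. *)
exists N, (fun i => [set x | i.+1%:R < psi (act (g_ i) x)]); split.
  move=> i; split; first exact: o_superlevel (c_act _).
  apply: sub_free_set (free_set_translate (g_ i) actX freeWF) => x /= ltx.
  by apply: psiW; exact: le_lt_trans ltx.
have coverU :
    ~` (\bigcup_(i : 'I_N) [set x | i.+1%:R < psi (act (g_ i) x)]) = set0.
  apply/seteqP; split => // x; apply; have [g gs bfg] := fb x.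
  have iN : (index g (s b) < N)%N by rewrite index_mem.
  exists (Ordinal iN) => //=; rewrite /g_ nth_index// /psi -mulrA.
  have N0 : 0 < N%:R :> R by rewrite ltr0n (leq_trans _ iN).
  apply: (@le_lt_trans _ _ N%:R); first by rewrite ler_nat.
  by rewrite ltr_pMr.
(* The uncovered remainder is empty and needs no pieces. Each boundary gets one piece per element of
   [s a]: an open band around its level, cut down to the points which that element sends into [V]
   after [g_ i]. *)
exists (fun o => if o is Some _ then size (s a) else 0%N).
exists (fun (o : option 'I_N) k => if o is Some i then
  [set x | `|psi (act (g_ i) x) - i.+1%:R| < 2^-1] `&`
    [set x | V (act (nth 1%g (s a) k * g_ i)%g x)] else set0).
exists (fun (o : option 'I_N) k =>
  if o is Some i then (nth 1%g (s a) k * g_ i)%g else 1%g).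
split.
- move=> [i|] k //= _; apply: openI.
    rewrite [X in open X](_ : _ =
      [set x | i.+1%:R - 2^-1 < (psi \o act (g_ i)) x] `&`
      [set x | (psi \o act (g_ i)) x < i.+1%:R + 2^-1]).
      apply: openI; first exact: o_superlevel.
      by have /continuousP/(_ _ (@open_lt R (i.+1%:R + 2^-1))) := c_act (g_ i).
    by apply/seteqP; split => x /=; rewrite ltr_distl => /andP.
  by have /continuousP/(_ _ oV) := cact (nth 1%g (s a) k * g_ i)%g.
- move=> [i|]; last by rewrite coverU.
  move=> x /(boundary_superlevel (c_act (g_ i))) /= psix.
  have [k ks Vkx] := Va (act (g_ i) x).
  exists (index k (s a)); first by rewrite /= index_mem.
  by split=> /=; rewrite ?psix ?subrr ?normr0 ?invr_gt0// nth_index// actM.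
- by move=> [i|] k //= _ _ [x [_ Vx] <-].
(* The bands have [psi] positive, so they are pushed into [W], and freeness over [s a] forces equal
   group elements. Cancelling them leaves one point whose [psi] is close to both levels, whence
   [i = j]. *)
- move=> [[i|] k] [[j|] l] //= ka lb [_ [[x [psix _] <-] [y [psiy _]]]].
  rewrite !actM.
  have pos (m : nat) (r : R) : `|r - m.+1%:R| < 2^-1 -> 0 < r.
    by rewrite ltr_distl -natr1 => /andP[+ _]; have := ler0n R m; lra.
  have Wx := psiW _ (pos _ _ psix); have Wy := psiW _ (pos _ _ psiy).
  move=> yx; have La m : (m < size (s a))%N -> L (nth 1%g (s a) m).
    by move=> ma; left; exact: mem_nth.
  have kl := free_setP freeW (La _ lb) (La _ ka) Wy Wx yx.
  have {}yx : act (g_ j) y = act (g_ i) x.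
    move: yx; rewrite kl => /(congr1 (act (nth 1%g (s a) k)^-1%g)).
    by rewrite -!(actM _^-1%g) !mulVg !act1.
  rewrite /= yx in psiy.
  (* Equal elements give equal positions because [s a] has no repetitions. *)
  move/eqP: kl; rewrite nth_uniq// => /eqP ->.
  suff -> : i = j by [].
  by apply: val_inj; exact: nat_near_inj psix psiy.
Qed.
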